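(* Let $X$ be a real Banach space and let $T$ be a countably compact (Hausdorff) topological space with a distinguished point $\infty\in T$. Suppose there is a function $f:T\to X$ such that: (i) $f(\infty)=0$; (ii) the set $Y:=\{x^*\in X^*: x^*\circ f \text{ is continuous}\}$ is a norming and norm-closed subspace of $X^*$; (iii) there exist $\varepsilon>0$ and $x^*_\infty\in X^*$ such that the set $D:=\{t\in T: x^*_\infty(f(t))>\varepsilon\}$ intersects every $G_\delta$-subset of $T$ containing $\infty$. Then $X$ is not fully Mackey complete.
   Context: A topological space is countably compact if every sequence in it has a cluster point. A linear subspace $Y\subset X^*$ is norming if $|||x|||=\sup\{x^*(x): x^*\in Y,\ \|x^*\|\le 1\}$ defines an equivalent norm on $X$. $X$ is fully Mackey complete if $(X,\mu(X,Y))$ is complete for every norming and norm-closed subspace $Y\subset X^*$, where $\mu(X,Y)$ is the locally convex topology on $X$ of uniform convergence on absolutely convex $w^*$-compact subsets of $Y$. *)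

(* Defs.v *)
From HB Require Import structures.
From mathcomp Require Import all_boot all_order all_algebra.
From mathcomp Require Import all_classical all_reals all_analysis.
From mathcomp Require Import borel_hierarchy.
Set Implicit Arguments. Unset Strict Implicit. Unset Printing Implicit Defensive.
Import Order.TTheory GRing.Theory Num.Theory.
Import numFieldNormedType.Exports.
Local Open Scope classical_set_scope.
Local Open Scope ring_scope.

Section Dual.
Variables (R : realType) (X : normedModType R).

Definition dual : set (X -> R) :=
  [set phi | (forall (a : R) (x y : X), phi (a *: x + y) = a * phi x + phi y)
             /\ continuous phi].

Definition dual_norm (phi : X -> R) : \bar R :=
  ereal_sup [set (`|phi x|)%:E | x in [set x : X | `|x| <= 1]].

Definition dual_subspace (Y : set (X -> R)) : Prop :=
  Y `<=` dual /\ Y (fun=> 0) /\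
  (forall (a : R) phi psi, Y phi -> Y psi -> Y (fun x => a * phi x + psi x)).

(* |||x||| = sup { phi x : phi in Y, ||phi|| <= 1 } is an equivalent norm.
   (|||x||| <= ||x|| always holds; so equivalence means a lower bound.) *)
Definition norming_norm (Y : set (X -> R)) (x : X) : \bar R :=
  ereal_sup [set (phi x)%:E | phi in [set phi | Y phi /\ (dual_norm phi <= 1)%E]].

Definition norming (Y : set (X -> R)) : Prop :=
  (exists2 c : R, 0 < c & forall x : X, ((c * `|x|)%R%:E <= norming_norm Y x)%E) /\
  (forall x : X, (norming_norm Y x <= (`|x|)%:E)%E).

Definition norm_closed (Y : set (X -> R)) : Prop :=
  forall phi, dual phi ->
    (forall e : R, 0 < e -> exists2 psi, Y psi &
        (dual_norm (fun x => (phi x - psi x)%R) < e%:E)%E) ->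
    Y phi.

Definition abs_convex (K : set (X -> R)) : Prop :=
  forall (a b : R) phi psi, K phi -> K psi -> `|a| + `|b| <= 1 ->
    K (fun x => a * phi x + b * psi x).

Definition wstar_compact (K : set (X -> R)) : Prop :=
  compact (K : set {ptws X -> R}).

Definition mackey_set (Y K : set (X -> R)) : Prop :=
  K `<=` Y /\ abs_convex K /\ wstar_compact K.

Definition seminorm_K (K : set (X -> R)) (x : X) : \bar R :=
  ereal_sup [set (`|phi x|)%:E | phi in K].

Definition mackey_cauchy (Y : set (X -> R)) (F : set_system X) : Prop :=
  forall K, mackey_set Y K -> forall e : R, 0 < e ->
    exists2 A, F A & forall x y, A x -> A y -> (seminorm_K K (x - y)%R < e%:E)%E.

Definition mackey_converges (Y : set (X -> R)) (F : set_system X) (x : X) : Prop :=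
  forall K, mackey_set Y K -> forall e : R, 0 < e ->
    F [set z | (seminorm_K K (z - x)%R < e%:E)%E].

Definition mackey_complete (Y : set (X -> R)) : Prop :=
  forall F : set_system X, ProperFilter F -> mackey_cauchy Y F ->
    exists x, mackey_converges Y F x.

Definition fully_mackey_complete : Prop :=
  forall Y, dual_subspace Y -> norming Y -> norm_closed Y -> mackey_complete Y.

End Dual.

Definition countably_compact (T : topologicalType) : Prop :=
  forall u : nat -> T, exists t : T, cluster (u @ \oo) t.

(* Main.v *)
(* Condition (iii) keeps xinf out of Y.  The sum Z = Y + R xinf is again norming and norm-closed,
   and on it the coefficient of xinf is a linear functional, [coef], that is no evaluation at a
   point x of X: such an x would be annihilated by Y, hence be 0.  By Grothendieck's completeness
   criterion it then suffices that [coef] is w*-continuous on each absolutely convex w*-compact K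
   in Z, i.e. that K meets Y in a relatively w*-closed set.
   If z in K with coefficient a > 0 were a w*-limit of points of the intersection, one could choose
   alternately y_n in it and t_n in D with y_m (f t_n) = 0 for m <= n and y_m (f t_n) >= a eps / 2
   for m > n.  A w*-cluster point w of (y_n) lies in Z, and (iii), used once more, puts w in Y.  But
   w o f is at least a eps / 2 at every t_n and vanishes at each cluster point of (t_n). *)
Require Import Defs.
From HB Require Import structures.
From mathcomp Require Import all_boot all_order all_algebra.
From mathcomp Require Import all_classical all_reals all_analysis.
From mathcomp Require Import borel_hierarchy.
From mathcomp Require Import ring lra.
Import Order.TTheory GRing.Theory Num.Theory.
Import numFieldNormedType.Exports.
Local Open Scope classical_set_scope.
Local Open Scope ring_scope.

(** * Approximation by evaluations on absolutely convex sets *)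

Lemma interval_separation (R : realType) (I : Type) (P : set I) (l u : I -> R) :
  (forall i j, P i -> P j -> l i <= u j) ->
  exists c, forall i, P i -> l i <= c <= u i.
Proof.
move=> lu; have [[i0 Pi0]|P0] := pselect (P !=set0); last first.
  by exists 0 => i Pi; case: P0; exists i.
have ubd j : P j -> ubound (l @` P) (u j) by move=> Pj _ [i Pi <-]; exact: lu.
exists (sup (l @` P)) => i Pi; apply/andP; split.
  by apply: ub_le_sup; [exists (u i0); exact: ubd|exists i].
by apply: ge_sup; [exists (l i0), i0|exact: ubd].
Qed.

Section AbsConvex.
Variables (R : realType) (X : normedModType R).
Implicit Types (K : set (X -> R)) (phi : (X -> R) -> R).

Definition linear_on K phi := forall (a b : R) k l, K k -> K l ->
  `|a| + `|b| <= 1 -> phi (fun x => a * k x + b * l x) = a * phi k + b * phi l.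

(** One Hahn-Banach step. Each [k] with [k x > 0] confines [c] to an interval, and any two of these
    meet by the bound on functionals vanishing at [x]. Convexity of [q] is asked only for
    [|a| + |b| = 1], so that [q] may contain an additive constant. *)
Lemma remove_evaluation K phi (q : (X -> R) -> R) (x : X) :
  abs_convex K -> linear_on K phi ->
  (forall (a b : R) k l, K k -> K l -> `|a| + `|b| = 1 ->
     q (fun x => a * k x + b * l x) <= `|a| * q k + `|b| * q l) ->
  (forall k, K k -> k x = 0 -> `|phi k| <= q k) ->
  exists c, forall k, K k -> `|phi k - c * k x| <= q k.
Proof.
move=> Kc phiK qK phi0.
have [|c cP] := @interval_separation R _ [set k | K k /\ 0 < k x]
    (fun k => (phi k - q k) / k x) (fun k => (phi k + q k) / k x).
  move=> k l [Kk kx] [Kl lx] /=.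
  have s0 : 0 < k x + l x by exact: addr_gt0.
  pose a := l x / (k x + l x); pose b := k x / (k x + l x).
  have a0 : 0 < a by exact: divr_gt0.
  have b0 : 0 < b by exact: divr_gt0.
  have ab : `|a| + `|- b| = 1.
    by rewrite normrN !gtr0_norm// -mulrDl addrC divff// gt_eqF.
  have ab1 : `|a| + `|- b| <= 1 by rewrite ab.
  have := phi0 _ (Kc _ _ _ _ Kk Kl ab1).
  have -> : a * k x + - b * l x = 0 by rewrite /a /b; ring.
  move=> /(_ erefl); rewrite phiK// => /le_trans /(_ (qK _ _ _ _ Kk Kl ab)).
  rewrite normrN (gtr0_norm a0) (gtr0_norm b0) => /(le_trans (ler_norm _)) H.
  rewrite ler_pdivrMr// mulrAC ler_pdivlMr//.
  have := ler_wpM2l (ltW s0) H.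
  have sa : l x = (k x + l x) * a by rewrite mulrC divfK// gt_eqF.
  have sb : k x = (k x + l x) * b by rewrite mulrC divfK// gt_eqF.
  by move: sa sb; set S := k x + l x => -> ->; lra.
exists c => k Kk.
have pos l : K l -> 0 < l x -> `|phi l - c * l x| <= q l.
  move=> Kl lx; have /andP[] := cP l (conj Kl lx).
  rewrite ler_pdivrMr// ler_pdivlMr// => h1 h2.
  by rewrite ler_norml; apply/andP; split; lra.
have [kx|kx|kx] := ltgtP (k x) 0; last by rewrite kx mulr0 subr0 phi0.
  (* Negative values reduce to positive ones: [-k] lies in [K], with coefficients -1 and 0. *)
  have h1 : `|-1| + `|0 : R| <= 1 by rewrite normrN normr1 normr0 addr0.
  have h2 : `|-1| + `|0 : R| = 1 by rewrite normrN normr1 normr0 addr0.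
  have := qK _ _ _ _ Kk Kk h2; rewrite normrN normr1 normr0 mul0r addr0 mul1r.
  apply: le_trans; have := pos _ (Kc _ _ _ _ Kk Kk h1); rewrite phiK//.
  rewrite !mul0r !addr0 !mulN1r mulrN -opprD normrN; apply.
  by rewrite oppr_gt0.
exact: pos.
Qed.

(** Induction on [xs]: each step subtracts a multiple of one evaluation and drops its term from the
    bound, until only [e] is left. *)
Lemma approx_by_evaluation (K : set (X -> R)) phi (e C : R) (xs : seq X) :
  K `<=` @dual R X -> abs_convex K -> linear_on K phi -> 0 <= C ->
  (forall k, K k -> `|phi k| <= e + C * \sum_(x <- xs) `|k x|) ->
  exists x, forall k, K k -> `|phi k - k x| <= e.
Proof.
move=> KD Kc + C0; elim: xs phi => [|x xs IH] phi phiK phiC.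
  exists 0 => k Kk; have /KD[/(_ (-1) 0 0)] := Kk.
  rewrite scaler0 addr0 mulN1r addNr => -> _.
  by have := phiC k Kk; rewrite big_nil mulr0 addr0 subr0.
have [||c cP] := @remove_evaluation K phi
    (fun k => e + C * \sum_(y <- xs) `|k y|) x Kc phiK.
- move=> a b k l Kk Kl ab.
  have -> : forall u, e + u = `|a| * e + `|b| * e + u.
    by move=> u; rewrite -mulrDl ab mul1r.
  suff : C * \sum_(y <- xs) `|a * k y + b * l y| <=
    C * (`|a| * (\sum_(y <- xs) `|k y|) + `|b| * \sum_(y <- xs) `|l y|) by lra.
  rewrite ler_wpM2l// !mulr_sumr -big_split/=; apply: ler_sum => y _.
  by rewrite -!normrM ler_normD.
- by move=> k Kk kx; have := phiC k Kk; rewrite big_cons kx normr0 add0r.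
have [|x' x'P] := IH (fun k => phi k - c * k x) _ cP.
  by move=> a b k l Kk Kl ab; rewrite phiK//; ring.
exists (c *: x + x') => k Kk; have [-> _] := KD _ Kk.
by rewrite opprD addrA x'P.
Qed.

End AbsConvex.

(** * Mackey sets and Mackey completeness *)

Lemma continuous_to_ptws (R : realType) (S X : topologicalType)
    (h : S -> {ptws X -> R}) :
  (forall x, continuous (fun s => h s x)) -> continuous h.
Proof. by move=> hc s; apply/pointwise_cvgP => x; exact: hc. Qed.

Lemma ptws_evaluation_continuous (R : realType) (X : topologicalType) (x : X) :
  continuous (fun k : {ptws X -> R} => k x).
Proof.
move=> k; have /pointwise_cvgP := @cvg_id _ (nbhs (k : {ptws X -> R})); exact.
Qed.

Section Mackey.
Variables (R : realType) (X : normedModType R) (Z : set (X -> R)).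
Hypothesis Zsub : dual_subspace Z.
Implicit Types (K L : set (X -> R)).

Lemma subspace_comb (a b : R) k l : Z k -> Z l -> Z (fun x => a * k x + b * l x).
Proof.
have [_ [Z0 Zl]] := Zsub; move=> Zk Zz; apply: (Zl) => //.
have := Zl b l (fun=> 0) Zz Z0.
by under [X in Z X]funext do rewrite addr0.
Qed.

Lemma abs_convex0 K : K !=set0 -> abs_convex K -> K (fun=> 0).
Proof.
move=> [k Kk] Kc; have := Kc 0 0 k k Kk Kk; rewrite normr0 addr0 => /(_ ler01).
by under [X in K X]funext do rewrite !mul0r addr0.
Qed.

Lemma mackey_segment z : Z z ->
  mackey_set Z [set (fun x => t * z x) | t in `[-1 : R, 1]].
Proof.
move=> Zz; split; [|split].
- move=> _ [t _ <-]; have := subspace_comb t 0 z z Zz Zz.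
  by under [X in Z X]funext do rewrite mul0r addr0.
- move=> a b _ _ [s + <-] [t + <-] ab.
  rewrite /= !in_itv/= -!ler_norml => s1 t1; exists (a * s + b * t).
    rewrite /= in_itv/= -ler_norml (le_trans (ler_normD _ _))// !normrM.
    by rewrite (le_trans _ ab)// lerD// ler_piMr.
  by apply/funext => x; ring.
- apply: (@continuous_compact R {ptws X -> R} (fun t x => t * z x)).
    apply: continuous_subspaceT; apply: continuous_to_ptws => x t.
    exact: mulrr_continuous.
  exact: segment_compact.
Qed.

Lemma mackey_sum K L : mackey_set Z K -> mackey_set Z L ->
  mackey_set Z [set kl.1 \+ kl.2 | kl in K `*` L].
Proof.
move=> [KZ [Kc Kk]] [LZ [Lc Lk]]; split; [|split].
- move=> _ [[k l] [/= /KZ Zk /LZ Zl] <-].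
  have := subspace_comb 1 1 k l Zk Zl.
  by under [X in Z X]funext do rewrite !mul1r.
- move=> a b _ _ [[k l] [/= Hk Hl] <-] [[k' l'] [/= Hk' Hl'] <-] ab.
  exists ((fun x => a * k x + b * k' x), (fun x => a * l x + b * l' x)).
    by split; [exact: Kc|exact: Lc].
  by apply/funext => x /=; ring.
- apply: (@continuous_compact ({ptws X -> R} * {ptws X -> R})%type
    {ptws X -> R} (fun kl x => kl.1 x + kl.2 x)); last exact: compact_setX.
  apply: continuous_subspaceT; apply: continuous_to_ptws => x [k l].
  have kx : kl.1 x @[kl --> (k, l)] --> k x.
    apply: (@cvg_comp _ _ _ fst (fun k : {ptws X -> R} => k x) _ (nbhs k)).
      exact: cvg_fst.
    exact: ptws_evaluation_continuous.
  have lx : kl.2 x @[kl --> (k, l)] --> l x.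
    apply: (@cvg_comp _ _ _ snd (fun k : {ptws X -> R} => k x) _ (nbhs l)).
      exact: cvg_snd.
    exact: ptws_evaluation_continuous.
  exact: (cvgD kx lx).
Qed.

(** The empty set also counts as a Mackey set, whence the case distinction. Having 0 in both
    summands puts [K] and [L] inside their sum. *)
Lemma mackey_enlarge K : mackey_set Z K ->
  exists L, [/\ mackey_set Z L, L (fun=> 0) & K `<=` L].
Proof.
move=> ZK; have [K0|K0] := pselect (K !=set0).
  by exists K; split=> //; apply: abs_convex0 K0 _; case: ZK => _ [].
have [_ [Z0 _]] := Zsub.
exists [set (fun x => t * 0) | t in `[-1 : R, 1]]; split.
- exact: mackey_segment Z0.
- exists 0; last by apply/funext => x; rewrite mulr0.
  by rewrite /= in_itv/=; lra.
- by move=> k Kk; case: K0; exists k.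
Qed.

(* One direction of Grothendieck's completeness theorem: the sets of [e]-approximants of [phi] on
   Mackey sets form a base of a Mackey-Cauchy filter, whose limit represents [phi]. *)
Lemma mackey_complete_evaluation (phi : (X -> R) -> R) :
  mackey_complete Z ->
  (forall K, mackey_set Z K -> forall e, 0 < e ->
     exists x, forall k, K k -> `|phi k - k x| <= e) ->
  exists x, forall z, Z z -> phi z = z x.
Proof.
move=> Zcomplete app.
pose D := [set Ke : set (X -> R) * R |
  [/\ mackey_set Z Ke.1, Ke.1 (fun=> 0) & 0 < Ke.2]].
pose B (Ke : set (X -> R) * R) :=
  [set x : X | forall k, Ke.1 k -> `|phi k - k x| <= Ke.2].
have [ZD [Z0 Zl]] := Zsub.
have FF : ProperFilter (filter_from D B).
  apply: filter_from_proper; last first.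
    by move=> [K e] [/= ZK _ e0]; have [x xP] := app K ZK e e0; exists x.
  apply: filter_from_filter.
    have [L [ZL L0 _]] := mackey_enlarge _ (mackey_segment _ Z0).
    by exists (L, 1); split => //=; exact: ltr01.
  move=> [K e] [L d] [/= ZK K0 e0] [/= ZL L0 d0].
  exists ([set kl.1 \+ kl.2 | kl in K `*` L], Num.min e d).
    split=> /=; [exact: mackey_sum| |by rewrite lt_min e0].
    by exists (fun=> 0, fun=> 0) => //; apply/funext => x /=; rewrite addr0.
  move=> x xP; split=> k Kk.
    apply: (le_trans (xP k _)); last by rewrite /= ge_min lexx.
    by exists (k, fun=> 0) => //; apply/funext => y /=; rewrite addr0.
  apply: (le_trans (xP k _)); last by rewrite /= ge_min lexx orbT.
  by exists (fun=> 0, k) => //; apply/funext => y /=; rewrite add0r.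
have [|x xP] := Zcomplete _ FF.
  move=> K ZK e e0; have [L [ZL L0 KL]] := mackey_enlarge K ZK.
  (* Two [e / 4]-approximants differ by at most [e / 2] on [K], so the supremum stays strictly below
     [e]. *)
  exists (B (L, e / 4)).
    by exists (L, e / 4) => //; split=> //=; rewrite divr_gt0.
  move=> x y Bx By; apply: (@le_lt_trans _ _ (e / 2)%:E); last first.
    by rewrite lte_fin; lra.
  apply: ge_ereal_sup => _ [k Kk <-]; rewrite lee_fin.
  have /ZD[+ _] : Z k by case: ZK => + _; apply.
  move=> /(_ (-1) y x); rewrite scaleN1r mulN1r addrC => ->.
  have := Bx _ (KL _ Kk); have := By _ (KL _ Kk) => /=; rewrite !ler_norml.
  by lra.
exists x => z Zz; apply/eqP; rewrite -subr_eq0 -normr_le0.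
apply/ler_addgt0Pr => e e0; rewrite add0r.
have e2 : 0 < e / 2 by rewrite divr_gt0.
(* The segment through [z] is a Mackey set detecting the value at [z]; [y] will be close both to
   [phi] and to the limit [x] on it. *)
have [L [ZL L0 KL]] := mackey_enlarge _ (mackey_segment z Zz).
have Lz : L z.
  apply: KL; exists 1; last by apply/funext => y; rewrite mul1r.
  by rewrite /= in_itv/=; lra.
have FB : filter_from D B (B (L, e / 2)) by exists (L, e / 2).
have [y [/= By]] := filter_ex (filterI FB (xP L ZL _ e2)).
move=> /(le_lt_trans (ereal_sup_ubound _)) => /(_ `|z (y - x)|%:E) H.
have {H} : (`|z (y - x)|%:E < (e / 2)%:E)%E by apply: H; exists z.
rewrite lte_fin; have /ZD[+ _] := Zz.
move=> /(_ (-1) x y); rewrite scaleN1r mulN1r addrC => ->.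
by have := By z Lz => /=; rewrite !ler_norml ltr_norml; lra.
Qed.

End Mackey.

(** * One-dimensional extension of a subspace of the dual *)

Section Adjoin.
Variables (R : realType) (X : normedModType R).
Implicit Types (Y : set (X -> R)) (v z phi : X -> R).

Lemma dual_norm_leP phi (M : R) :
  (dual_norm phi <= M%:E)%E <-> forall x, `|x| <= 1 -> `|phi x| <= M.
Proof.
split=> [/ereal_supP H x x1|H].
  by rewrite -lee_fin; apply: H; exists x.
by apply/ereal_supP => _ [x x1 <-]; rewrite lee_fin; exact: H.
Qed.

Lemma dualZ phi (a : R) x : dual phi -> phi (a *: x) = a * phi x.
Proof.
move=> [phil _]; have phi0 : phi 0 = 0.
  by have := phil (-1) 0 0; rewrite scaler0 addr0 mulN1r addNr.
by have := phil a x 0; rewrite addr0 phi0 addr0.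
Qed.

Lemma dual_norm_le1 phi x : dual phi -> (dual_norm phi <= 1)%E -> phi x <= `|x|.
Proof.
move=> phiD /(dual_norm_leP phi 1) phi1; have [->|x0] := eqVneq x 0.
  by rewrite -(scale0r 0) dualZ// mul0r scale0r normr0.
have nx0 : 0 < `|x| by rewrite normr_gt0.
have := phi1 (`|x|^-1 *: x); rewrite normrZ normfV normr_id mulVf ?gt_eqF//.
move=> /(_ (lexx _)); rewrite dualZ// normrM normfV normr_id.
by rewrite ler_pdivrMl// mulr1 => /(le_trans (ler_norm _)).
Qed.

Lemma dual_bounded phi : dual phi ->
  exists2 M : R, 0 <= M & forall x, `|x| <= 1 -> `|phi x| <= M.
Proof.
move=> phiD; have [_ phic] := phiD; have phi0 : phi 0 = 0.
  by rewrite -(scale0r 0) dualZ// mul0r.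
have /cvgr_dist_lt/(_ 1 ltr01)/nbhs_ballP[d /= d0 dP] := phic 0.
exists (2 / d) => [|x x1]; first by rewrite divr_ge0// ltW.
have : ball 0 d ((d / 2) *: x).
  rewrite -ball_normE/= sub0r normrN normrZ gtr0_norm ?divr_gt0//.
  by rewrite (@le_lt_trans _ _ (d / 2))// ?ler_piMr//; lra.
move=> /dP; rewrite /= phi0 sub0r normrN dualZ// normrM gtr0_norm ?divr_gt0//.
rewrite -ltr_pdivlMl ?divr_gt0// mulr1 invf_div; exact: ltW.
Qed.

Lemma dual_subspace_dual : dual_subspace (@dual R X).
Proof.
split=> //; split.
  by split=> [a x y|]; [rewrite mulr0 addr0|exact: cst_continuous].
move=> a phi psi [phil phic] [psil psic]; split=> [b x y|x].
  by rewrite phil psil; ring.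
have ax : a * phi y @[y --> x] --> a * phi x.
  by apply: cvgMr; exact: phic.
have px : psi y @[y --> x] --> psi x by exact: psic.
exact: (cvgD ax px).
Qed.

Definition adjoin Y v : set (X -> R) :=
  [set z | exists a : R, Y (fun x => z x - a * v x)].

(** [get] returns some such [a], unique once [v] is outside [Y]; for [z] outside [adjoin Y v] it is
    a meaningless default. *)
Definition coef Y v z : R := get [set a : R | Y (fun x => z x - a * v x)].

Variables (Y : set (X -> R)) (v : X -> R).
Hypotheses (Ysub : dual_subspace Y) (vD : dual v) (Yv : ~ Y v).

(** Two different coefficients would make [v] a multiple of a difference of two elements of [Y]. *)
Lemma coefE (a : R) z : Y (fun x => z x - a * v x) -> coef Y v z = a.
Proof.
move=> Ya; rewrite /coef; set b := get _.
have Yb : Y (fun x => z x - b * v x).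
  by apply: (@getPex _ [set b | Y (fun x => z x - b * v x)]); exists a.
apply: contra_notP Yv => /eqP; rewrite eq_sym -subr_eq0 => ab0.
have := subspace_comb _ _ _ Ysub ((a - b)^-1) (- (a - b)^-1) _ _ Yb Ya.
by congr Y; apply/funext => x; rewrite -[RHS](mulKf ab0); ring.
Qed.

Lemma adjoin_coef z : adjoin Y v z -> Y (fun x => z x - coef Y v z * v x).
Proof.
move=> [a Ya].
by apply: (@getPex _ [set b | Y (fun x => z x - b * v x)]); exists a.
Qed.

Lemma sub_adjoin : Y `<=` adjoin Y v.
Proof.
move=> y Yy; exists 0.
by under [X in Y X]funext do rewrite mul0r subr0.
Qed.

Lemma coef_sub y : Y y -> coef Y v y = 0.
Proof.
by move=> Yy; apply: coefE; under [X in Y X]funext do rewrite mul0r subr0.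
Qed.

Lemma coef_adjoined : coef Y v v = 1.
Proof.
apply: coefE; under [X in Y X]funext do rewrite mul1r subrr.
by case: Ysub => _ [].
Qed.

Lemma adjoin_adjoined : adjoin Y v v.
Proof.
exists 1; under [X in Y X]funext do rewrite mul1r subrr.
by case: Ysub => _ [].
Qed.

Lemma coef_linear (a b : R) k l : adjoin Y v k -> adjoin Y v l ->
  coef Y v (fun x => a * k x + b * l x) = a * coef Y v k + b * coef Y v l.
Proof.
move=> /adjoin_coef Yk /adjoin_coef Yl; apply: coefE.
have := subspace_comb _ _ _ Ysub a b _ _ Yk Yl.
by congr Y; apply/funext => x; ring.
Qed.

Lemma adjoin_subspace : dual_subspace (adjoin Y v).
Proof.
have [YD [Y0 Yl]] := Ysub; split; [|split].
- move=> z [a /YD zD].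
  have := subspace_comb _ _ _ dual_subspace_dual 1 a _ _ zD vD.
  by congr dual; apply/funext => x; ring.
- exact: sub_adjoin.
- move=> a k l [b Yk] [c Yl']; exists (a * b + c).
  have := Yl a _ _ Yk Yl'.
  by congr Y; apply/funext => x; ring.
Qed.

Lemma adjoin_norming : norming Y -> norming (adjoin Y v).
Proof.
have [ZD _] := adjoin_subspace.
move=> [[c c0 cY] _]; split.
  exists c => // x; apply: (le_trans (cY x)); apply: ereal_sup_le.
  by move=> _ [phi [Yphi phi1] <-]; exists phi => //; split=> //; exact: sub_adjoin.
move=> x; apply: ge_ereal_sup => _ [phi [/ZD phiD phi1] <-].
by rewrite lee_fin; exact: dual_norm_le1.
Qed.

(** Were no [d] to work, the quotients [y / a] would approximate [v] in norm. The bound [M] on the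
    unit ball stands for the norm of [a * v - y], avoiding extended reals. *)
Lemma distance_to_subspace : norm_closed Y -> exists2 d : R, 0 < d &
  forall (a M : R) y, Y y -> (forall x, `|x| <= 1 -> `|a * v x - y x| <= M) ->
    `|a| * d <= M.
Proof.
move=> Yc; apply: contra_notP Yv => /forall2NP Yd; apply: Yc => // e e0.
have [//|] := Yd e; move=> /existsNP[a /existsNP[M /existsNP[y]]].
move=> /not_implyP[Yy /not_implyP[aM /negP]]; rewrite -ltNge => Mad.
have M0 : 0 <= M by apply: le_trans (aM 0 _); rewrite ?normr0.
have a0 : 0 < `|a|.
  rewrite lt_def normr_ge0 andbT; apply: contraTneq Mad => ->.
  by rewrite mul0r -leNgt.
exists (fun x => a^-1 * y x + 0 * y x).
  exact: subspace_comb.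
apply: (@le_lt_trans _ _ (M / `|a|)%:E).
  apply/dual_norm_leP => x x1; rewrite ler_pdivlMr// mulrC -normrM.
  rewrite mulrBr mul0r addr0 mulVKf; first exact: aM.
  by rewrite -normr_gt0.
by rewrite lte_fin ltr_pdivrMr// mulrC.
Qed.

(** If [y + a * v] is within [e] of [phi], the coefficient sought is within [e / d] of [a]. These
    intervals pairwise meet, hence share a point [c], and [phi - c * v] is then a norm limit of
    elements of [Y]. *)
Lemma adjoin_norm_closed : norm_closed Y -> norm_closed (adjoin Y v).
Proof.
move=> Yc phi phiD app; have [d d0 dP] := distance_to_subspace Yc.
pose P (ae : R * R) := exists2 y, Y y &
  forall x, `|x| <= 1 -> `|phi x - y x - ae.1 * v x| <= ae.2.
have [|c cP] := @interval_separation R _ P (fun ae => ae.1 - ae.2 / d)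
    (fun ae => ae.1 + ae.2 / d).
  move=> [a e] [a' e'] [y Yy /= ye] [y' Yy' /= ye'].
  have := dP (a - a') (e + e') _ (subspace_comb _ _ _ Ysub 1 (-1) _ _ Yy' Yy).
  move=> /(_ _)/wrap[x x1|].
    have := ye x x1; have := ye' x x1; rewrite !ler_norml; lra.
  rewrite -ler_pdivlMr// mulrDl => /(le_trans (ler_norm _)); lra.
have [M M0 vM] := dual_bounded v vD.
exists c; apply: Yc => [|e e0].
  have := subspace_comb _ _ _ dual_subspace_dual 1 (- c) _ _ phiD vD.
  by congr dual; apply/funext => x; ring.
have s0 : 0 < 1 + d^-1 * M.
  by rewrite ltr_pwDl// mulr_ge0// invr_ge0 ltW.
(* The error [e'] of the approximation and [e' / d * M] from replacing [a] by [c] add up to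
   [e / 2]. *)
pose e' := e / 2 / (1 + d^-1 * M).
have e'0 : 0 < e' by rewrite !divr_gt0.
have [psi [a Ya] /ltW/dual_norm_leP psie] := app e' e'0.
exists (fun x => psi x - a * v x) => //.
apply: (@le_lt_trans _ _ (e / 2)%:E); last by rewrite lte_fin; lra.
apply/dual_norm_leP => x x1.
have /cP/= : P (a, e').
  exists (fun x => psi x - a * v x) => //= y y1.
  have -> : phi y - (psi y - a * v y) - a * v y = phi y - psi y by ring.
  exact: psie.
move=> ac; have {}ac : `|a - c| <= e' / d by rewrite ler_norml; lra.
have -> : phi x - c * v x - (psi x - a * v x) =
  (phi x - psi x) + (a - c) * v x by ring.
rewrite (le_trans (ler_normD _ _))// normrM.
rewrite (@le_trans _ _ (e' + e' / d * M))//.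
  by rewrite lerD ?psie// ler_pM// vM.
by rewrite -mulrA -[X in X + _]mulr1 -mulrDr divfK// gt_eqF.
Qed.

End Adjoin.

Arguments adjoin {R X} Y v.
Arguments coef {R X} Y v z.

(** * Cluster points, common zeros and inductive choice *)

Lemma cluster_closed (S U : topologicalType) (u : nat -> S) (s : S) (g : S -> U)
    (A : set U) (N : nat) :
  cluster (u @ \oo) s -> continuous g -> closed A ->
  (forall n, (N <= n)%N -> A (g (u n))) -> A (g s).
Proof.
move=> us gc Ac Au; apply: Ac => B gsB.
have [] := us (g @^-1` A) (g @^-1` B); last by move=> x [Ax Bx]; exists (g x).
  by exists N => // n /= /Au.
exact: gc.
Qed.

Lemma Gdelta_common_zeros (R : realType) (T : topologicalType)
    (g : nat -> T -> R) :
  (forall n, continuous (g n)) -> Gdelta [set t | forall n, g n t = 0].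
Proof.
move=> gc.
(* The intersection runs over codes of pairs [(n, m)]; a code that decodes to nothing contributes
   the whole space. *)
exists (fun i => if @unpickle (nat * nat)%type i is Some (n, m)
  then [set t | `|g n t| < m.+1%:R^-1] else setT).
  move=> i; case: (unpickle i) => [[n m]|]; last exact: openT.
  apply: (@open_comp _ _ (fun t => `|g n t|) [set r | r < m.+1%:R^-1]).
    by move=> t _; apply: cvg_norm; exact: gc.
  exact: open_lt.
apply/seteqP; split=> [t gt0 i _|t tP n].
  by case: (unpickle i) => [[n m]|] //=; rewrite gt0 normr0 invr_gt0.
apply/eqP; rewrite -normr_le0 leNgt; apply/negP => gt.
have [m] := ltr_add_invr gt; rewrite add0r => /ltW; rewrite leNgt => /negP; apply.
by have := tP (pickle (n, m)) I; rewrite pickleK.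
Qed.

(** The relation is demanded from every earlier term, so the recursion carries the list of all
    previous choices. *)
Lemma dependent_sequence (P : choiceType) (good : set P) (r : P -> P -> Prop) :
  (forall s : seq P, (forall p, p \in s -> good p) ->
     exists q, good q /\ forall p, p \in s -> r p q) ->
  exists u : nat -> P, (forall n, good (u n)) /\
    forall m n, (m < n)%N -> r (u m) (u n).
Proof.
move=> next.
have /choice[g gP] : forall s : seq P, exists q, (forall p, p \in s -> good p) ->
    good q /\ forall p, p \in s -> r p q.
  move=> s; have [/next[q qP]|sbad] := pselect (forall p, p \in s -> good p).
    by exists q.
  (* For a list with a bad entry any value will do; the empty list supplies one. *)
  by have [q _] := next [::] (fun p => ltac:(by [])); exists q => /sbad.
pose h n := iter n (fun s => g s :: s) [::].
have hgood n p : p \in h n -> good p.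
  elim: n p => [//|n IH] p; rewrite /h iterS inE => /orP[/eqP->|]; last exact: IH.
  by have [] := gP _ IH.
exists (fun n => g (h n)); split=> [n|m n mn].
  by have [] := gP _ (hgood n).
have [_] := gP _ (hgood n); apply.
elim: n mn => [//|n IH]; rewrite ltnS leq_eqVlt /h iterS inE.
by move=> /orP[/eqP->|/IH ->]; rewrite ?eqxx ?orbT.
Qed.

(** * The alternating sequence of points and functionals *)

Section Core.
Variables (R : realType) (X : normedModType R) (T : topologicalType) (inf : T).
Variables (f : T -> X) (eps : R) (xinf : X -> R).
Let Y : set (X -> R) := [set phi | dual phi /\ continuous (phi \o f)].
Hypotheses (Tcc : countably_compact T) (finf : f inf = 0).
Hypothesis eps0 : 0 < eps.
Hypothesis Dmeets : forall G : set T, Gdelta G -> G inf ->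
  ([set t | eps < xinf (f t)] `&` G) !=set0.

(** Members of [Y] vanish at [f inf = 0], so their common zeros along [f] form a G-delta set
    containing [inf]. *)
Lemma common_zero (g : nat -> X -> R) : (forall n, Y (g n)) ->
  exists2 t, eps < xinf (f t) & forall n, g n (f t) = 0.
Proof.
move=> gY; have [||t [tD t0]] := Dmeets [set t | forall n, g n (f t) = 0].
- by apply: (@Gdelta_common_zeros _ _ (fun n => g n \o f)) => n; case: (gY n).
- move=> n; rewrite finf; have [gD _] := gY n.
  by rewrite -(scale0r 0) dualZ// mul0r.
- by exists t.
Qed.

Lemma xinf_notin : ~ Y xinf.
Proof.
move=> Yx; have [t xt] := common_zero (fun=> xinf) (fun=> Yx).
by move=> /(_ 0%N) xt0; move: xt; rewrite xt0 ltNge ltW.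
Qed.

Lemma closure_coef_le0 (K : set (X -> R)) z :
  K `<=` adjoin Y xinf -> wstar_compact K -> adjoin Y xinf z ->
  (forall (xs : seq X) (d : R), 0 < d -> exists2 y, K y /\ Y y &
     forall x, x \in xs -> `|y x - z x| <= d) ->
  coef Y xinf z <= 0.
Proof.
move=> KZ Kcpt Zz zP; rewrite leNgt; apply/negP => a0; set a := coef _ _ _ in a0.
(* Where [y0 (f t) = 0] and [eps < xinf (f t)], the value [z (f t)] exceeds [a * eps]; an error of
   half that amount leaves the lower bound [d]. *)
pose y0 x := z x - a * xinf x.
have Yy0 : Y y0 by exact: adjoin_coef.
have d0 : 0 < a * eps / 2 by rewrite divr_gt0// mulr_gt0.
set d := a * eps / 2 in d0.
have [|u [ugood ur]] := @dependent_sequence (T * (X -> R))%type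
  [set p | [/\ K p.2 /\ Y p.2, eps < xinf (f p.1), y0 (f p.1) = 0 &
    p.2 (f p.1) = 0]]
  (fun p q => d <= q.2 (f p.1) /\ p.2 (f q.1) = 0).
  move=> s sgood; have [y [Ky Yy] yz] := zP [seq f p.1 | p <- s] d d0.
  (* The new [t] must be a zero of [y0], of the new [y] and of all earlier functionals; [y0] pads
     this list to a sequence. *)
  pose ys := y0 :: y :: [seq p.2 | p <- s].
  have [|t tD t0] := common_zero (fun n => nth y0 ys n).
    case=> [|[|n]] //=; have [ns|ns] := ltnP n (size s); last first.
      by rewrite nth_default// size_map.
    by have /mapP[p /sgood[[_ ?] _ _ _] ->] := mem_nth y0
      (ltac:(by rewrite size_map) : (n < size [seq p.2 | p <- s])%N).
  exists (t, y); split=> [|p ps].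
    by split=> //=; [have := t0 0%N|have := t0 1%N].
  split=> /=.
    have [_ pD py0 _] := sgood p ps.
    have := yz _ (map_f (fun p => f p.1) ps); rewrite ler_norml => /andP[+ _].
    move: py0; rewrite /y0; have := ltr_pM2l a0 eps (xinf (f p.1)).
    by rewrite pD /d; move=> ?; lra.
  have := t0 (index p.2 ys).
  by rewrite nth_index// !inE map_f ?orbT.
have [t tP] := Tcc (fun n => (u n).1).
have [w [Kw wP]] : exists w : {ptws X -> R},
    (K `&` cluster ((fun n => (u n).2 : {ptws X -> R}) @ \oo)) w.
  by apply: Kcpt; exists 0%N => // n _ /=; have [[]] := ugood n.
have evw x (A : set R) N : closed A -> (forall n, (N <= n)%N -> A ((u n).2 x)) -> A (w x).
  exact: (cluster_closed _ _ _ _ _ A N wP (@ptws_evaluation_continuous R X x)).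
(* [(u n).2 \o f] is continuous and vanishes at [(u m).1] for all [m >= n], its own index
   included. *)
have ut n : (u n).2 (f t) = 0.
  have [[_ [_ uc]] _ _ self] := ugood n.
  apply: (cluster_closed _ _ _ _ _ [set r | r = 0] n tP uc).
    exact: closed_eq.
  move=> m /=; rewrite leq_eqVlt => /orP[/eqP<- //|/ur[]//].
(* At a common zero [t'] of all [(u m).2] and of the [Y]-part of [w], also [w] vanishes while [xinf]
   does not; so [w] has coefficient 0. *)
have [|t' t'D t'0] := common_zero (fun n => if n is m.+1 then (u m).2
    else fun x => w x - coef Y xinf w * xinf x).
  by case=> [|n]; [exact: adjoin_coef _ _ _ _ _ (KZ _ Kw)|have [[]] := ugood n].
have wt' : w (f t') = 0.
  by apply: (evw _ [set r | r = 0] 0%N (@closed_eq _ _)) => n _; exact: (t'0 n.+1).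
have b0 : coef Y xinf w = 0.
  have /= := t'0 0%N; rewrite wt' sub0r => /eqP; rewrite oppr_eq0 mulf_eq0.
  by move=> /orP[/eqP//|/eqP x0]; move: t'D; rewrite x0 ltNge ltW.
have [_ wc] : Y w.
  have := adjoin_coef _ _ _ _ _ (KZ _ Kw); rewrite b0.
  by under [X in Y X]funext do rewrite mul0r subr0.
have wt : w (f t) = 0.
  by apply: (evw _ [set r | r = 0] 0%N (@closed_eq _ _)) => n _; exact: ut.
(* Limits in the other order: [n] at fixed [k] gives [d <= w (f (u k).1)], then [k] gives the bound
   at [t]. *)
have : d <= w (f t).
  apply: (cluster_closed _ _ _ _ _ [set r | d <= r] 0%N tP wc (@closed_ge _ _)).
  move=> k _ /=; apply: (evw _ [set r | d <= r] k.+1 (@closed_ge _ _)) => n kn.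
  by have [] := ur _ _ kn.
by rewrite wt leNgt d0.
Qed.

End Core.

(** * Continuity of the coefficient on Mackey sets *)

Lemma le_sum_norm (R : realDomainType) (I : eqType) (g : I -> R) (s : seq I) i :
  i \in s -> `|g i| <= \sum_(j <- s) `|g j|.
Proof.
move=> si; rewrite (perm_big _ (perm_to_rem si)) big_cons lerDl.
by apply: sumr_ge0.
Qed.

Section CoefContinuity.
Variables (R : realType) (X : normedModType R) (Y : set (X -> R)) (v : X -> R).
Hypotheses (Ysub : dual_subspace Y) (vD : dual v) (Yv : ~ Y v).
Variable K : set (X -> R).
Hypotheses (KZ : K `<=` adjoin Y v) (Kc : abs_convex K).

Lemma coefZ (c : R) k : K k -> coef Y v (fun x => c * k x + 0 * k x) = c * coef Y v k.
Proof. by move=> Kk; rewrite coef_linear ?mul0r ?addr0//; exact: KZ. Qed.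

(* On an absolutely convex set, a functional with relatively closed kernel is continuous at 0:
   otherwise one gets [k] near 0 with [coef k = e], and then [(k0 - k) / 2] tends to [k0 / 2]
   inside the kernel. *)
Lemma coef_continuous0 :
  (forall z, adjoin Y v z ->
    (forall (xs : seq X) (d : R), 0 < d -> exists2 y, K y /\ Y y &
       forall x, x \in xs -> `|y x - z x| <= d) -> coef Y v z <= 0) ->
  forall e : R, 0 < e -> exists xs : seq X, exists2 d : R, 0 < d &
    forall k, K k -> (forall x, x \in xs -> `|k x| <= d) -> `|coef Y v k| <= e.
Proof.
move=> clos e e0; apply: contrapT => /forallNP ndiscr.
have H (xs : seq X) (d : R) : 0 < d -> exists k, [/\ K k, coef Y v k = e &
    forall x, x \in xs -> `|k x| <= d].
  move=> d0; have /forall2NP/(_ d)[//|] := ndiscr xs.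
  move=> /existsNP[k /not_implyP[Kk /not_implyP[kd /negP]]]; rewrite -ltNge => ke.
  have k0 : coef Y v k != 0 by rewrite -normr_gt0; exact: lt_trans ke.
  have c1 : `|e / coef Y v k| <= 1.
    rewrite normrM normfV gtr0_norm// ler_pdivrMr ?mul1r ?ltW//.
    by rewrite normr_gt0.
  (* Scaling down to coefficient exactly [e] stays in [K] and shrinks the values; [0 * k x] only
     fits the two-term form of [abs_convex]. *)
  exists (fun x => e / coef Y v k * k x + 0 * k x); split.
  - by apply: Kc => //; rewrite normr0 addr0.
  - by rewrite coefZ// divfK.
  - move=> x /kd kx; rewrite mul0r addr0 normrM.
    by rewrite (le_trans _ kx)// ler_piMl.
have [k0 [Kk0 k0e _]] := H [::] 1 ltr01.
have : coef Y v (fun x => 2^-1 * k0 x + 0 * k0 x) <= 0.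
  apply: clos; first by apply: subspace_comb => //; [exact: adjoin_subspace|exact: KZ|exact: KZ].
  move=> xs d d0; have [k [Kk ke kd]] := H xs d d0.
  (* The halves make this an absolutely convex combination; the equal coefficients cancel, putting
     it in [Y]. *)
  have Ky : K (fun x => 2^-1 * k0 x + (- 2^-1) * k x).
    by apply: Kc => //; rewrite normrN gtr0_norm//; lra.
  exists (fun x => 2^-1 * k0 x + (- 2^-1) * k x) => [|x /kd kx].
    split=> //; have := adjoin_coef _ _ _ _ _ (KZ _ Ky).
    rewrite coef_linear//; [|exact: KZ|exact: KZ].
    rewrite k0e ke mulNr subrr.
    by congr Y; apply/funext => x; rewrite mul0r subr0.
  have -> : 2^-1 * k0 x + (- 2^-1) * k x - (2^-1 * k0 x + 0 * k0 x) = - (2^-1 * k x) by ring.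
  rewrite normrN normrM gtr0_norm//; have := normr_ge0 (k x); lra.
by rewrite coefZ// k0e pmulr_rle0// leNgt e0.
Qed.

(** Scaling by [d / s] when the sum [s] of the [|k x|] exceeds [d] turns continuity at 0 into
    [|coef Y v k| <= e + e / d * s], the input of [approx_by_evaluation]. *)
Lemma coef_approx :
  (forall e : R, 0 < e -> exists xs : seq X, exists2 d : R, 0 < d &
    forall k, K k -> (forall x, x \in xs -> `|k x| <= d) -> `|coef Y v k| <= e) ->
  forall e : R, 0 < e -> exists x, forall k, K k -> `|coef Y v k - k x| <= e.
Proof.
move=> cont e e0; have [xs [d d0 small]] := cont e e0.
have [ZD _] := adjoin_subspace _ _ _ _ Ysub vD.
apply: (@approx_by_evaluation _ _ _ _ e (e / d) xs _ Kc) => //.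
- by move=> k /KZ/ZD.
- by move=> a b k l /KZ Zk /KZ Zl _; rewrite coef_linear.
- by rewrite divr_ge0 ?ltW.
move=> k Kk; set s := \sum_(x <- xs) _.
have s0 : 0 <= s by apply: sumr_ge0.
have [sd|sd] := leP s d.
  apply: (@le_trans _ _ e); last by rewrite lerDl mulr_ge0// divr_ge0 ?ltW.
  by apply: small => // x xxs; rewrite (le_trans _ sd)//; exact: (le_sum_norm _ _ k).
have sp : 0 < s by exact: lt_trans sd.
have r1 : `|d / s| <= 1 by rewrite gtr0_norm ?divr_gt0// ler_pdivrMr// mul1r ltW.
have : `|coef Y v (fun x => d / s * k x + 0 * k x)| <= e.
  apply: small; first by apply: Kc => //; rewrite normr0 addr0.
  move=> x xxs; rewrite mul0r addr0 normrM gtr0_norm ?divr_gt0//.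
  rewrite mulrAC ler_pdivrMr// ler_pM2l//; exact: (le_sum_norm _ _ k).
rewrite coefZ// normrM gtr0_norm ?divr_gt0// -ler_pdivlMl ?divr_gt0// invf_div.
by move=> /le_trans; apply; lra.
Qed.

End CoefContinuity.

(** * Failure of Mackey completeness for [adjoin Y xinf] *)

Theorem theorem4p1 (R : realType) (X : completeNormedModType R)
  (T : topologicalType) (inf : T) (f : T -> X) :
  hausdorff_space T ->
  countably_compact T ->
  f inf = 0 ->
  (let Y := [set phi | @dual R X phi /\ continuous (phi \o f)] in
   dual_subspace Y /\ norming Y /\ norm_closed Y) ->
  (exists eps : R, 0 < eps /\ exists2 xinf : X -> R, @dual R X xinf &
     forall G : set T, Gdelta G -> G inf ->
       ([set t | eps < xinf (f t)] `&` G) !=set0) ->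
  ~ @fully_mackey_complete R X.
Proof.
move=> _ Tcc finf [Ysub [Yn Yc]] [eps [eps0 [xinf xinfD Dmeets]]] Xcomplete.
set Y := [set phi | _] in Ysub Yn Yc.
have Yx : ~ Y xinf by apply: xinf_notin finf _ Dmeets.
have Zsub := adjoin_subspace _ _ _ _ Ysub xinfD.
have [||x xP] := mackey_complete_evaluation _ _ _ Zsub (coef Y xinf).
- by apply: Xcomplete; [exact: Zsub|exact: adjoin_norming|exact: adjoin_norm_closed].
- move=> K [KZ [Kc Kk]]; apply: coef_approx => //; apply: coef_continuous0 => //.
  by move=> z Zz zP; exact: (closure_coef_le0 _ _ _ _ _ _ _ Tcc finf eps0 Dmeets K z KZ Kk Zz zP).
have x0 : x = 0.
  have [[c c0 cY] _] := Yn; apply/eqP; rewrite -normr_le0 -(pmulr_rle0 _ c0).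
  rewrite -lee_fin; apply: (le_trans (cY x)); apply: ge_ereal_sup.
  move=> _ [y [Yy _] <-]; rewrite lee_fin -xP; last exact: sub_adjoin.
  by rewrite coef_sub.
have := xP _ (adjoin_adjoined _ _ _ _ Ysub); rewrite coef_adjoined// x0.
by rewrite -(scale0r 0) dualZ// mul0r => /eqP; rewrite oner_eq0.
Qed.
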